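(* Let $F$ be a finite graph with $v$ vertices, $\ell$ edges and minimum degree $\delta>1$. Then: (1) for all integers $n\ge v$, $$\mathrm{wsat}(n,F)\ \ge\ \left(\frac{\delta}{2}-\frac{1}{\delta+1}\right)(n-v)+\ell-1;$$ (2) if $\delta$ is odd and $F$ is connected, then, for all integers $n\ge v$, $$\mathrm{wsat}(n,F)\ \ge\ \left(\frac{\delta}{2}-\frac{1}{2(\delta+2)}\right)(n-v)+\ell-1;$$ (3) if either $\delta$ is even and $F$ is connected, or $\delta$ is arbitrary and $F$ is 2-edge-connected, then, for all integers $n\ge v$, $$\mathrm{wsat}(n,F)\ \ge\ \frac{\delta}{2}(n-v)+\ell-1.$$
   Context: All graphs are finite and simple. Given a graph $F$, an $F$-bootstrap percolation process is a sequence of graphs $H_0\subset H_1\subset\cdots\subset H_m$ on the same vertex set such that, for each $i=1,\ldots,m$, $H_i$ is obtained from $H_{i-1}$ by adding one edge that belongs to a copy of $F$ (a not necessarily induced subgraph isomorphic to $F$) in $H_i$. A graph $H$ on $[n]=\{1,\ldots,n\}$ is weakly $F$-saturated if there is an $F$-bootstrap percolation process $H=H_0\subset\cdots\subset H_m=K_n$. The number $\mathrm{wsat}(n,F)$ is the minimum number of edges of a weakly $F$-saturated graph on $[n]$. A graph is $k$-edge-connected if it remains connected whenever at most $k-1$ edges are removed. *)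

(* Defs.v *)
From HB Require Import structures.
From mathcomp Require Import all_boot all_order all_algebra.

Set Implicit Arguments.
Unset Strict Implicit.
Unset Printing Implicit Defensive.

Record sgraph (V : finType) := SGraph {
  edges : {set {set V}};
  _ : [forall e in edges, #|e| == 2] }.

HB.instance Definition _ (V : finType) := [isSub for @edges V].
HB.instance Definition _ (V : finType) := [Finite of sgraph V by <:].

Section Graphs.
Variables (V : finType) (G : sgraph V).

(* The singleton [set x; x] is never an edge, so [adj] is irreflexive. *)
Definition adj : rel V := fun x y => [set x; y] \in edges G.

Definition degree (x : V) : nat := #|[set y | adj x y]|.

(* Degrees are smaller than #|V|, so the default value #|V| of the iterated
   minimum only matters for the graph without vertices. *)
Definition min_degree : nat := \big[minn/#|V|]_(x : V) degree x.

Definition connected : bool := [forall x, forall y, connect adj x y].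

Lemma remove_edges_subproof (S : {set {set V}}) :
  [forall e in edges G :\: S, #|e| == 2].
Proof.
apply/forall_inP => e /setDP[eG _].
by case: G eG => E /= /forall_inP; apply.
Qed.

Definition remove_edges (S : {set {set V}}) : sgraph V :=
  SGraph (remove_edges_subproof S).

End Graphs.

Definition edge_connected (V : finType) (k : nat) (G : sgraph V) : bool :=
  [forall S : {set {set V}},
     (S \subset edges G) && (#|S| < k) ==> connected (remove_edges G S)].

Lemma complete_subproof (V : finType) :
  [forall e in [set e : {set V} | #|e| == 2], #|e| == 2].
Proof. by apply/forall_inP => e; rewrite inE. Qed.

Definition complete (V : finType) : sgraph V := SGraph (complete_subproof V).

Section Percolation.
Variables (V W : finType) (F : sgraph V).

Definition map_edges (f : V -> W) : {set {set W}} :=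
  [set f @: d | d : {set V} in edges F].

(* e lies in a (not necessarily induced) subgraph of H isomorphic to F. *)
Definition in_copy (H : sgraph W) (e : {set W}) : bool :=
  [exists f : {ffun V -> W},
     [&& injectiveb f, map_edges f \subset edges H & e \in map_edges f]].

Definition percolation_step : rel (sgraph W) := fun H H' =>
  [exists e : {set W},
     [&& e \notin edges H, edges H' == e |: edges H & in_copy H' e]].

(* By [connectP], a process is a [path] for [percolation_step]. *)
Definition weakly_saturated (H : sgraph W) : bool :=
  connect percolation_step H (complete W).

Lemma weakly_saturated_complete : weakly_saturated (complete W).
Proof. exact: connect0. Qed.

End Percolation.

(* [weakly_saturated_complete] is the side condition which makes this [arg min]
   a genuine minimizer. *)
Definition wsat (n : nat) (V : finType) (F : sgraph V) : nat :=
  #|edges [arg min_(H < complete 'I_n | weakly_saturated F H) #|edges H| ]|.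

Lemma wsatP (n : nat) (V : finType) (F : sgraph V) :
  (exists2 H : sgraph 'I_n, weakly_saturated F H & #|edges H| = wsat n F) /\
  (forall H : sgraph 'I_n, weakly_saturated F H -> wsat n F <= #|edges H|).
Proof.
rewrite /wsat; case: arg_minnP => [|H HF Hmin].
  exact: weakly_saturated_complete.
by split; first exists H.
Qed.

(* Main.v *)
Require Import Defs.
From mathcomp Require Import all_boot all_order all_algebra.
From mathcomp Require Import perm zify lra.

(** Partition the edges present at each stage of the process into blocks, a block
    on the vertex set [U] weighing [c (|U| - v) + l - 1], or [1] if it is a single
    edge.  The initial graph, split into single edges, weighs its number of edges.
    When the process completes a copy of [F], merging the blocks which meet this
    copy does not increase the total weight: this reduces to the inequality
    [c |S| + 1 <= t(S)] for [S] a nonempty proper set of vertices of [F], where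
    [t(S)] is the number of edges of [F] meeting [S].  At the end all edges of [K_n]
    can be merged into one block, of weight [c (n - v) + l - 1].
    The inequality on [t(S)] follows from [2 t(S) = \sum_(x in S) deg x + b(S)],
    with [b(S)] the number of edges leaving [S], and, when [|S| <= delta], from
    [t(S) >= delta |S| - 'C(|S|, 2)]. *)

Set Implicit Arguments.
Unset Strict Implicit.
Unset Printing Implicit Defensive.

Import Order.TTheory GRing.Theory Num.Theory.

(** * Edges of a graph that meet, or leave, a vertex set *)

Section Boundary.
Variables (V : finType) (F : sgraph V).

Definition touching (S : {set V}) : {set {set V}} :=
  [set e in edges F | ~~ [disjoint e & S]].

Definition boundary (S : {set V}) : {set {set V}} :=
  [set e in edges F | #|e :&: S| == 1].

Lemma edge_card e : e \in edges F -> #|e| = 2.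
Proof. by case: F => E HE /= eE; apply/eqP; move/forall_inP: HE; apply. Qed.

Lemma adj_neq x y : adj F x y -> x != y.
Proof.
move=> /edge_card; apply: contra_eqN => /eqP ->.
by rewrite setUid cards1.
Qed.

Lemma degree_edges x : degree F x = #|[set e in edges F | x \in e]|.
Proof.
rewrite /degree -(card_in_imset (f := fun y => [set x; y])).
  apply: eq_card => e; rewrite !inE; apply/imsetP/andP.
    by case=> y; rewrite inE => xy ->; rewrite !inE eqxx.
  case=> eF xe; have /cards2P[a [b [_ eab]]]: #|e| == 2 by rewrite edge_card.
  move: xe; rewrite eab !inE => /orP[] /eqP ->.
    by exists b; rewrite // inE /adj -eab.
  by exists a; rewrite ?inE /adj setUC // -eab.
move=> y z; rewrite !inE => /adj_neq xy /adj_neq xz /setP /(_ y).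
by rewrite !inE eqxx orbT eq_sym (negPf xy) /= => /esym/eqP.
Qed.

Lemma sum_degree (S : {set V}) :
  \sum_(x in S) degree F x = \sum_(e in edges F) #|e :&: S|.
Proof.
under eq_bigr do rewrite degree_edges -sum1dep_card big_mkcondr /=.
rewrite exchange_big /=; apply: eq_bigr => e _.
rewrite -big_mkcondr /= sum1dep_card; apply: eq_card => x.
by rewrite !inE andbC.
Qed.

(** An edge inside [S] is counted twice by the degrees; an edge leaving [S] is counted once by them
    and once by [boundary]. *)
Lemma card_touching S : #|touching S| * 2 = \sum_(x in S) degree F x + #|boundary S|.
Proof.
rewrite sum_degree -!sum1dep_card !big_mkcondr -big_split /= big_distrl /=.
apply: eq_bigr => e eF; rewrite -setI_eq0 -cards_eq0.
have := subset_leq_card (subsetIl e S); rewrite (edge_card eF).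
by case: #|e :&: S| => [|[|[|k]]].
Qed.

(** The degree sum counts twice only the edges inside [S], and these are at most ['C(#|S|, 2)]. *)
Lemma touching_lower (S : {set V}) :
  \sum_(x in S) degree F x <= #|touching S| + 'C(#|S|, 2).
Proof.
have H : #|[set e in edges F | e \subset S]| <= 'C(#|S|, 2).
  rewrite -cards_draws; apply/subset_leq_card/subsetP => e.
  by rewrite !inE => /andP[/edge_card -> ->]; rewrite eqxx.
apply: leq_trans (leq_add (leqnn _) H).
rewrite sum_degree -!sum1dep_card !big_mkcondr -big_split /=.
apply: leq_sum => e eF; rewrite -setI_eq0 -cards_eq0.
have := subset_leq_card (subsetIl e S); rewrite (edge_card eF).
case E : #|e :&: S| => [|[|[|k]]] // _.
suff -> : e \subset S by [].
by apply/setIidPl/eqP; rewrite eqEcard subsetIl (edge_card eF) E.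
Qed.

Lemma min_degree_le x : min_degree F <= degree F x.
Proof.
rewrite /min_degree; have := mem_index_enum x.
elim: (index_enum V) => // y s IHs; rewrite inE big_cons geq_min.
by case/predU1P => [->|/IHs ->]; rewrite ?leqnn ?orbT.
Qed.

Lemma sum_degree_ge (S : {set V}) : min_degree F * #|S| <= \sum_(x in S) degree F x.
Proof.
by rewrite mulnC -sum_nat_const; apply: leq_sum => x _; apply: min_degree_le.
Qed.

(** With no edge leaving it, [S] would be closed under adjacency and contain every vertex reachable
    from it. *)
Lemma connected_boundary (S : {set V}) :
  connected F -> S != set0 -> S != setT -> 0 < #|boundary S|.
Proof.
move=> Fconn /set0Pn[x xS] SnT; rewrite card_gt0; apply: contra SnT => /eqP b0.
have adjS a b : adj F a b -> a \in S -> b \in S.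
  move=> ab aS; apply: contraT => bS.
  suff: [set a; b] \in boundary S by rewrite b0 inE.
  rewrite inE [_ \in edges F]ab /=; apply/cards1P; exists a; apply/setP => z.
  rewrite !inE; have [->|_] := eqVneq z a; first by rewrite aS.
  by have [->|//] := eqVneq z b; rewrite (negPf bS).
apply/eqP/setP => y; rewrite inE.
have/connectP[p] := forallP (forallP Fconn x) y.
elim: p x xS => [|z p IHp] x xS /=; first by move=> _ ->.
by case/andP=> /adjS/(_ xS) zS /IHp; apply.
Qed.

End Boundary.

(** Removing the edges that leave [S] separates it from its complement. *)
Lemma edge_connected_boundary (V : finType) (F : sgraph V) k S :
  edge_connected k F -> S != set0 -> S != setT -> k <= #|boundary F S|.
Proof.
move=> /forallP/(_ (boundary F S)) Fk S0 ST; rewrite leqNgt; apply/negP => bk.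
have bF : boundary F S \subset edges F by apply/subsetP => e /setIdP[].
move: Fk; rewrite bF bk /= => /connected_boundary/(_ S0 ST).
case/card_gt0P => e; rewrite !inE => /andP[/andP[+ eF] e1].
by rewrite eF e1.
Qed.

(** Writing x for [#|S|] and d for the minimum degree, [touching_lower] gives 2 t(S) >= d x + x (d +
    1 - x), and x (d + 1 - x) >= d >= 2 for 1 <= x <= d. *)
Lemma touching_small (V : finType) (F : sgraph V) (S : {set V}) :
    1 < min_degree F -> S != set0 -> #|S| <= min_degree F ->
  min_degree F * #|S| + 2 <= #|touching F S| * 2.
Proof.
rewrite -card_gt0 => d1 S0 Sd.
have := touching_lower F S; have := sum_degree_ge F S.
have := mul_bin_left #|S| 1; rewrite bin1.
set d := min_degree F in d1 Sd *; set x := #|S| in S0 Sd *.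
set t := #|_|; set C := 'C(_, _); nia.
Qed.

Lemma leq_card_bigcup (I T : finType) (A : {set I}) (E : I -> {set T}) :
  #|\bigcup_(i in A) E i| <= \sum_(i in A) #|E i|.
Proof.
elim/big_rec2: _ => [|i n B _ IH]; first by rewrite cards0.
exact: leq_trans (leq_card_setU _ _).1 (leq_add (leqnn _) IH).
Qed.

Local Open Scope ring_scope.

(** * Weights of blocks and merging along a copy of [F] *)

Section Weight.
Variables (V W : finType) (F : sgraph V) (c : rat).

Local Notation copy f := (map_edges (W := W) F f).
Local Notation l := #|edges F|.

Definition weight (B : {set {set W}}) : rat :=
  if #|B| == 1%N then 1 else c * (#|cover B|%:R - #|V|%:R) + l%:R - 1.

Hypothesis c_ge0 : 0 <= c.
Hypothesis many_touching : forall S : {set V}, S != set0 -> S != setT ->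
  c * #|S|%:R + 1 <= #|touching F S|%:R.

Lemma card_copy (f : V -> W) : injective f -> #|copy f| = l.
Proof. by move=> f_inj; rewrite card_imset //; apply: imset_inj. Qed.

Lemma cover_copy (f : V -> W) : cover (copy f) \subset f @: setT.
Proof. by apply/bigcupsP => _ /imsetP[d _ ->]; apply: imsetS. Qed.

(** Let S be the set of vertices of [F] sent outside [cover B]. The edges shared by [B] and the copy
    avoid the image of S, so they number at most l - t(S), and [many_touching] bounds t(S). If S is
    empty, the missing edge of the copy supplies the needed 1. *)
Lemma weight_ge (f : V -> W) (B : {set {set W}}) :
    injective f -> ~~ [disjoint B & copy f] ->
    ~~ (copy f \subset B) ->
  #|B :&: copy f|%:R + c * #|cover B :\: f @: setT|%:R <= weight B.
Proof.
move=> f_inj Bf fB; rewrite /weight; case: ifPn => [/cards1P[g Bg]|_].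
  have gf : g \in copy f.
    by move: Bf; rewrite Bg -setI_eq0 => /set0Pn[h]; rewrite !inE => /andP[/eqP ->].
  have -> : cover B :\: f @: setT = set0.
    apply/eqP; rewrite setD_eq0 Bg cover1.
    by apply: subset_trans (cover_copy f); apply: bigcup_max gf _.
  rewrite cards0 mulr0 addr0 -[leRHS]/(1%:R) ler_nat -(cards1 g) -Bg.
  exact/subset_leq_card/subsetIl.
pose A := f @^-1: cover B.
have cardB : #|cover B| = (#|A| + #|cover B :\: f @: setT|)%N.
  rewrite -(cardsID (f @: setT) (cover B)); congr (_ + _)%N.
  rewrite -(card_imset _ f_inj); apply: eq_card => y; rewrite !inE.
  apply/andP/imsetP => [[yB /imsetP[x _ yx]]|[x]].
    by exists x; rewrite // inE -yx.
  by rewrite inE => xB ->; rewrite xB imset_f.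
have cardA : (#|A| + #|~: A|)%N = #|V| by rewrite cardsC.
suff : #|B :&: copy f|%:R + 1 + c * #|~: A|%:R <= l%:R :> rat.
  rewrite cardB -cardA !natrD; lra.
have [AT|AnT] := eqVneq (~: A) set0.
  rewrite AT cards0 mulr0 addr0 natr1 ler_nat -(card_copy f_inj).
  apply: proper_card; rewrite properEneq subsetIr andbT.
  by apply: contra fB => /eqP/setIidPr.
have A0 : ~: A != setT.
  move: Bf; rewrite -setI_eq0 => /set0Pn[g /setIP[gB /imsetP[d dF gd]]].
  have /card_gt0P[x xd] : (0 < #|d|)%N by rewrite (edge_card dF).
  apply/eqP => /setP/(_ x); rewrite !inE => /negP; apply.
  by apply/bigcupP; exists g; rewrite // gd imset_f.
have := many_touching AnT A0.
suff : (#|B :&: copy f| + #|touching F (~: A)| <= l)%N.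
  by rewrite -(ler_nat rat) natrD; lra.
rewrite -(cardsID (touching F (~: A)) (edges F)) addnC leq_add //.
  by apply/subset_leq_card/subsetP => e; rewrite !inE => /andP[-> ->].
rewrite -(card_imset _ (imset_inj f_inj)); apply/subset_leq_card/subsetP => g.
case/setIP => gB /imsetP[d dF gd]; rewrite gd imset_f // !inE dF /= negbK andbT.
rewrite -subsets_disjoint; apply/subsetP => x xd; rewrite inE.
by apply/bigcupP; exists g; rewrite // gd imset_f.
Qed.

(** All blocks meeting the copy are replaced by their union with it. By [weight_ge] they weigh at
    least l - 1, for the copy edges already in [X], plus c for each vertex they add to the copy. The
    last conclusion drives the final merging in the complete graph. *)
Lemma merge_blocks (P : {set {set {set W}}}) (X : {set {set W}}) (f : V -> W) :
    partition P X -> injective f -> (1 < l)%N ->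
    (l <= #|X :&: copy f| + 1)%N ->
    {in P, forall B : {set {set W}}, ~~ (copy f \subset B)} ->
  exists P' : {set {set {set W}}}, [/\ partition P' (X :|: copy f),
    \sum_(B in P') weight B <= \sum_(B in P) weight B &
    copy f \subset X -> (#|P'| < #|P|)%N].
Proof.
move=> partP f_inj l_gt1 lX fP.
pose Q := [set B in P | ~~ [disjoint B & copy f]].
have QP : Q \subset P by apply/subsetP => B /setIdP[].
have [/eqP covP trivP P0] := and3P partP.
pose N := copy f :|: cover Q.
(* The merged block is not a single edge, so the general formula gives its weight. *)
have cardN : (1 < #|N|)%N.
  by rewrite (leq_trans l_gt1) // -(card_copy f_inj) subset_leq_card ?subsetUl.
have partD : partition (P :\: Q) (cover (P :\: Q)).
  by rewrite /partition eqxx trivIsetD //= inE negb_and P0 orbT.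
have disjN : {in P :\: Q, forall B : {set {set W}}, [disjoint N & B]}.
  move=> B /setDP[BP BQ]; apply/pred0P => g /=; apply/andP => -[+ gB].
  have fB : [disjoint B & copy f] by move: BQ; rewrite inE BP negbK.
  rewrite inE (disjointFr fB gB) => /bigcupP[C CQ gC].
  have CB : C != B by apply: contraNneq BQ => <-.
  have := trivIsetP trivP C B (subsetP QP C CQ) BP CB.
  by move/disjointFr/(_ gC); rewrite gB.
have [_ trivD D0] := and3P partD.
have [_ NPQ] := trivIsetU1 disjN trivD D0.
have PE : P = Q :|: P :\: Q by rewrite -{1}(setID P Q) (setIidPr QP).
have disjQ : [disjoint Q & P :\: Q] by rewrite disjoints_subset setCD subsetUr.
have meetQ B g : B \in P -> g \in B -> g \in copy f -> B \in Q.
  by move=> BP gB gf; rewrite inE BP; apply/pred0Pn; exists g; rewrite /= gB.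
exists (N |: (P :\: Q)); split.
- have -> : X :|: copy f = N :|: cover (P :\: Q).
    by rewrite -covP /N setUC {1}PE /cover bigcup_setU setUA.
  apply: partitionU1 => //; first by rewrite -card_gt0 ltnW.
  exact: bigcup_disjoint disjN.
- rewrite big_setU1 //= [leRHS](big_setID Q) (setIidPr QP) lerD2r.
  have wQ : \sum_(B in Q) (#|B :&: copy f|%:R + c * #|cover B :\: f @: setT|%:R)
              <= \sum_(B in Q) weight B.
    by apply: ler_sum => B /setIdP[BP Bf]; apply: weight_ge => //; apply: fP.
  apply: le_trans wQ; rewrite big_split /= -natr_sum -mulr_sumr -natr_sum.
  (* Blocks outside [Q] share nothing with the copy, so the sum may run over all of [P]. *)
  have -> : (\sum_(B in Q) #|B :&: copy f|)%N = #|X :&: copy f|.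
    have cardI (A : {set {set W}}) :
        #|A :&: copy f| = (\sum_(g in A | g \in copy f) 1)%N.
      by rewrite -sum1_card; apply: eq_bigl => g; rewrite in_setI.
    rewrite -covP cardI big_trivIset_cond //.
    rewrite (eq_bigl _ _ (in_set _)) big_mkcondr /=.
    by apply: eq_bigr => B BP; rewrite -cardI -setI_eq0 -cards_eq0; case: eqP.
  rewrite /weight ifN ?gtn_eqF //.
  have le_cover : (#|cover N| <= #|V| + \sum_(B in Q) #|cover B :\: f @: setT|)%N.
    apply: leq_trans (leq_add (leqnn _) (leq_card_bigcup Q _)).
    rewrite -cardsT -(card_imset _ f_inj).
    apply: leq_trans _ (leq_card_setU _ _).1; apply/subset_leq_card/subsetP => x.
    case/bigcupP => g gN xg; rewrite inE; case: (boolP (x \in f @: setT)) => //= xf.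
    have [gf|gf] := boolP (g \in copy f).
      by case/negP: xf; apply: subsetP (cover_copy f) _ _; apply/bigcupP; exists g.
    move: gN; rewrite inE (negPf gf) => /bigcupP[B BQ gB].
    by apply/bigcupP; exists B; rewrite // inE xf; apply/bigcupP; exists g.
  move: le_cover lX; rewrite -!(ler_nat rat) !natrD => le_cover lX.
  have := ler_wpM2l c_ge0 le_cover; lra.
- move=> fX; rewrite cardsU1 NPQ [in ltnRHS]PE cardsU (disjoint_setI0 disjQ) cards0 subn0.
  (* If only one block met the copy, it would contain the whole copy. *)
  rewrite ltn_add2r ltnNge; apply/negP => Q1.
  have /card_gt0P[g gf] : (0 < #|copy f|)%N by rewrite card_copy // ltnW.
  have := subsetP fX g gf; rewrite -covP => /bigcupP[B BP gB].
  have BQ := meetQ B g BP gB gf.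
  move/negP: (fP B BP); apply; apply/subsetP => h hf.
  have := subsetP fX h hf; rewrite -covP => /bigcupP[C CP hC].
  have <- : C = B by apply: (card_le1_eqP Q1) => //; apply: (meetQ C h).
  exact: hC.
Qed.

(** * Embeddings of [F], and partitions along the process *)

Lemma exists_injective : (#|V| <= #|W|)%N -> exists f : V -> W, injective f.
Proof.
move=> VW; exists (fun u => enum_val (widen_ord VW (enum_rank u))).
by move=> u w /enum_val_inj/(congr1 val) /= uw; apply/enum_rank_inj/val_inj.
Qed.

(** Any injection is corrected at [a], [b], [z] in turn by transpositions, each fixing the values
    already set. This serves to place two adjacent edges of [F] on two given adjacent edges. *)
Lemma injective_through3 (a b z : V) (x y t : W) : (#|V| <= #|W|)%N ->
    a != b -> a != z -> b != z -> x != y -> x != t -> y != t ->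
  exists f : V -> W, [/\ injective f, f a = x, f b = y & f z = t].
Proof.
move=> /exists_injective[f0 f0_inj] ab az bz xy xt yt.
pose f1 u := tperm (f0 a) x (f0 u).
have f1_inj : injective f1 by move=> u w /perm_inj/f0_inj.
have f1a : f1 a = x by rewrite /f1 tpermL.
pose f2 u := tperm (f1 b) y (f1 u).
have f2_inj : injective f2 by move=> u w /perm_inj/f1_inj.
have f1b : f1 b != x by rewrite -f1a (inj_eq f1_inj) eq_sym.
have f2a : f2 a = x by rewrite /f2 f1a tpermD // eq_sym.
have f2b : f2 b = y by rewrite /f2 tpermL.
have f2zx : f2 z != x by rewrite -f2a (inj_eq f2_inj) eq_sym.
have f2zy : f2 z != y by rewrite -f2b (inj_eq f2_inj) eq_sym.
exists (fun u => tperm (f2 z) t (f2 u)); split.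
- by move=> u w /perm_inj/f2_inj.
- by rewrite f2a tpermD // eq_sym.
- by rewrite f2b tpermD // eq_sym.
- by rewrite tpermL.
Qed.

Lemma process_partition (H H' : sgraph W) :
    (1 < l)%N -> connect (percolation_step F) H H' ->
  exists2 P : {set {set {set W}}}, partition P (edges H') &
    \sum_(B in P) weight B <= #|edges H|%:R.
Proof.
move=> l_gt1 /connectP[p + ->].
(* The bound refers to the initial graph [H] while [G] moves along the process. *)
suff IH (G G' : sgraph W) (P : {set {set {set W}}}) : partition P (edges G) ->
    \sum_(B in P) weight B <= #|edges H|%:R ->
    forall q, path (percolation_step F) G q -> G' = last G q ->
  exists2 P : {set {set {set W}}}, partition P (edges G') &
    \sum_(B in P) weight B <= #|edges H|%:R.
  move=> Hp; have set1I := @set1_inj {set W}.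
  apply: (IH H _ (set1 @: edges H)) Hp _ => //.
    apply/and3P; split.
    - by rewrite cover_imset; apply/eqP/setP => e; apply/bigcupP/idP;
        [case=> d dH; rewrite inE => /eqP -> | exists e; rewrite ?inE].
    - apply/trivIsetP => _ _ /imsetP[d _ ->] /imsetP[e _ ->] de.
      by rewrite disjoints1 inE; apply: contraNneq de => ->.
    - by apply/imsetP => -[e _ /setP/(_ e)]; rewrite !inE eqxx.
  rewrite big_imset /=; last by move=> d e _ _ /set1I.
  rewrite (eq_bigr (fun=> 1)); last by move=> e _; rewrite /weight cards1.
  by rewrite sumr_const.
move=> + + q; elim: q G P => [|G1 q IHq] G P partP wP /=.
  by move=> _ ->; exists P.
case/andP=> /existsP[e /and3P[eG /eqP G1E /existsP[f]]].
case/and3P=> /injectiveP f_inj fG1 ef.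
have GfE : edges G :|: copy f = edges G1.
  rewrite G1E in fG1 *; apply/eqP; rewrite eqEsubset subUset subsetUr fG1 /=.
  by rewrite subUset subsetUl sub1set inE ef orbT.
case: (merge_blocks partP f_inj l_gt1).
- rewrite -(card_copy f_inj) -(cardsID (edges G) (copy f)) setIC leq_add2l -(cards1 e).
  apply/subset_leq_card/subsetP => g /setDP[gf gG].
  by move/subsetP: fG1 => /(_ g gf); rewrite G1E !inE (negPf gG) orbF.
(* A block containing the copy would contain the new edge [e], which is not yet in [G]. *)
- move=> B BP; apply: contra eG => /subsetP/(_ e ef).
  by apply: subsetP; apply: partitionS BP.
- move=> P1 [partP1 wP1 _]; apply: IHq (le_trans wP1 wP).
  by rewrite -GfE.
Qed.

(** Among the partitions of the edges of the complete graph of weight at most [#|edges H|], one with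
    the fewest blocks is chosen. By [merge_blocks] each copy of [F] lies in one of its blocks. Any
    two adjacent edges lie in a common copy, so there is only one block. *)
Lemma weakly_saturated_ge (H : sgraph W) :
    (forall x : V, 1 < degree F x)%N -> (0 < #|V|)%N -> (#|V| <= #|W|)%N ->
    weakly_saturated F H ->
  c * (#|W|%:R - #|V|%:R) + l%:R - 1 <= #|edges H|%:R.
Proof.
move=> deg2 /card_gt0P[a _] VW wsatH.
have /card_gt1P[b [z [+ + bz]]] := deg2 a; rewrite !inE => ab az.
have l_gt1 : (1 < l)%N.
  apply: leq_trans (deg2 a) _; rewrite degree_edges.
  by apply/subset_leq_card/subsetP => e /setIdP[].
have [P0 partP0 wP0] := process_partition l_gt1 wsatH.
pose good (P : {set {set {set W}}}) := partition P (edges (complete W)) &&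
  (\sum_(B in P) weight B <= #|edges H|%:R).
have good0 : good P0 by apply/andP.
case: (arg_minnP (fun P : {set {set {set W}}} => #|P|) good0) => P /andP[partP wP] minP.
have copyK f : injective f -> copy f \subset edges (complete W).
  move=> f_inj; apply/subsetP => _ /imsetP[d dF ->].
  by rewrite inE card_imset // (edge_card dF).
have in_block f : injective f -> exists2 B, B \in P & copy f \subset B.
  move=> f_inj; apply/exists_inP; rewrite -[X in is_true X]negbK; apply/exists_inPn => nP.
  case: (merge_blocks partP f_inj l_gt1 _ nP).
    by rewrite (setIidPr (copyK f f_inj)) (card_copy f_inj) leq_addr.
  move=> P' [partP' wP' /(_ (copyK f f_inj))].
  rewrite ltnNge => /negP; apply; apply: minP; apply/andP; split.
    by rewrite (setUidPl (copyK f f_inj)) in partP'.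
  exact: le_trans wP' wP.
have [/eqP covP trivP P_neq0] := and3P partP.
have same_block x y t : x != y -> x != t ->
    pblock P [set x; y] = pblock P [set x; t].
  move=> xy xt; have [<-//|yt] := eqVneq y t.
  have [f [f_inj fa fb fz]] :=
    injective_through3 VW (adj_neq ab) (adj_neq az) bz xy xt yt.
  have [B BP /subsetP fB] := in_block f f_inj.
  rewrite !(def_pblock trivP BP) //; apply: fB; apply/imsetP.
    by exists [set a; z]; rewrite // imsetU1 imset_set1 fa fz.
  by exists [set a; b]; rewrite // imsetU1 imset_set1 fa fb.
(* If [x] and [t] differ, the edge [[set x; t]] is adjacent or equal to both edges and links their
   blocks. *)
have same_block2 x y t u : x != y -> t != u ->
    pblock P [set x; y] = pblock P [set t; u].
  move=> xy; have [<-|xt tu] := eqVneq x t; first exact: same_block.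
  rewrite (same_block x y t) // setUC.
  by apply: same_block; rewrite // eq_sym.
have [f0 f0_inj] := exists_injective VW.
have [B BP fB] := in_block f0 f0_inj.
have cardB : (1 < #|B|)%N.
  by apply: leq_trans (subset_leq_card fB); rewrite card_copy.
have [g gB] : exists g, g \in B by apply/card_gt0P/ltnW.
have BE e : e \in edges (complete W) -> e \in B.
  move=> eK; have := subsetP (partitionS partP BP) g gB.
  have eP : e \in cover P by rewrite covP.
  move: (eK); rewrite !inE => /cards2P[t [u [tu eE]]] /cards2P[x [y [xy gE]]].
  rewrite -(def_pblock trivP BP gB) gE (same_block2 x y t u xy tu) -eE.
  by rewrite mem_pblock.
have PE : P = [set B].
  apply/setP => C; rewrite inE; apply/idP/eqP => [CP|-> //].
  have /set0Pn[e eC] : C != set0 by apply: contraNneq P_neq0 => <-.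
  have eB := BE e (subsetP (partitionS partP CP) e eC).
  by rewrite -(def_pblock trivP CP eC) (def_pblock trivP BP eB).
have coverB : cover B = setT.
  apply/setP => x; rewrite inE.
  have /card_gt0P[y] : (0 < #|[set~ x]|)%N.
    rewrite cardsC1 -subn1 subn_gt0; apply: leq_trans VW.
    by apply/card_gt1P; exists b, z.
  rewrite !inE eq_sym => xy; apply/bigcupP; exists [set x; y]; last by rewrite !inE eqxx.
  by apply: BE; rewrite inE cards2 xy.
by move: wP; rewrite PE big_set1 /weight gtn_eqF // coverB cardsT.
Qed.
End Weight.

(** * Lower bounds on [wsat] and the choice of c *)

Lemma wsat_ge (V : finType) (F : sgraph V) (c : rat) (n : nat) :
    (1 < min_degree F)%N -> (#|V| <= n)%N -> 0 <= c ->
    (forall S : {set V}, S != set0 -> S != setT ->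
      c * #|S|%:R + 1 <= #|touching F S|%:R) ->
  c * (n%:R - #|V|%:R) + #|edges F|%:R - 1 <= (wsat n F)%:R.
Proof.
move=> d_gt1 Vn c_ge0 many_touching.
have [[H wsatH <-] _] := wsatP n F.
(* Without vertices, [min_degree] takes its default value [#|V|], which is 0. *)
have V_gt0 : (0 < #|V|)%N.
  rewrite lt0n; apply/negP => /eqP/card0_eq V0; move: d_gt1.
  by rewrite /min_degree big_pred0 ?(eq_card0 V0) // => x; have := V0 x.
rewrite -[n in n%:R]card_ord.
apply: weakly_saturated_ge => //; last by rewrite card_ord.
by move=> x; apply: leq_trans d_gt1 (min_degree_le F x).
Qed.

Theorem theorem1p1 (V : finType) (F : sgraph V) (v l delta : nat)
    (hv : #|V| = v) (hl : #|edges F| = l)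
    (hdelta : min_degree F = delta) (delta_gt1 : (1 < delta)%N) :
  [/\ forall n : nat, (v <= n)%N ->
        (delta%:R / 2 - 1 / (delta%:R + 1)) * (n%:R - v%:R) + l%:R - 1
          <= (wsat n F)%:R :> rat,
      odd delta -> connected F -> forall n : nat, (v <= n)%N ->
        (delta%:R / 2 - 1 / (2 * (delta%:R + 2))) * (n%:R - v%:R) + l%:R - 1
          <= (wsat n F)%:R :> rat
    & (~~ odd delta /\ connected F) \/ edge_connected 2 F ->
      forall n : nat, (v <= n)%N ->
        delta%:R / 2 * (n%:R - v%:R) + l%:R - 1
          <= (wsat n F)%:R :> rat].
Proof.
subst v l delta; set d := min_degree F.
have d_ge2 : (2 : rat) <= d%:R by rewrite ler_nat.
have twice_touching (S : {set V}) :
    (d * #|S| + #|boundary F S| <= #|touching F S| * 2)%N.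
  by rewrite card_touching leq_add2r sum_degree_ge.
(* Under this condition c = d / 2 works for [S]. The terms subtracted in (1) and (2) compensate for
   the sets where it may fail. *)
have enough (S : {set V}) : (d * #|S| + 2 <= #|touching F S| * 2)%N ->
    (d%:R / 2) * #|S|%:R + 1 <= #|touching F S|%:R :> rat.
  by rewrite -(ler_nat rat) natrD !natrM; lra.
split.
- have e_ge0 : 0 <= 1 / (d%:R + 1) :> rat by apply: divr_ge0; lra.
  have e_le1 : 1 / (d%:R + 1) <= 1 :> rat by rewrite ler_pdivrMr; lra.
  move=> n Vn; apply: wsat_ge => // [|S S0 _]; first lra.
  have [Sd|dS] := leqP #|S| d.
    have := enough S (touching_small delta_gt1 S0 Sd).
    have := mulr_ge0 e_ge0 (ler0n rat #|S|); lra.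
  (* As [#|S|] is at least d + 1, the subtracted term saves a full 1, and t(S) >= d [#|S|] / 2
     suffices. *)
  have : 1 <= 1 / (d%:R + 1) * #|S|%:R :> rat.
    by rewrite mulrC mul1r ler_pdivlMr ?mul1r ?natr1 ?ler_nat //; lra.
  have := leq_trans (leq_addr _ _) (twice_touching S).
  by rewrite -(ler_nat rat) !natrM; lra.
- move=> d_odd Fconn.
  have e_ge0 : 0 <= 1 / (2 * (d%:R + 2)) :> rat by apply: divr_ge0; lra.
  have e_le1 : 1 / (2 * (d%:R + 2)) <= 1 :> rat by rewrite ler_pdivrMr; lra.
  move=> n Vn; apply: wsat_ge => // [|S S0 ST]; first lra.
  have b_gt0 := connected_boundary Fconn S0 ST.
  have [large|] := leqP (d * #|S| + 2) (#|touching F S| * 2).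
    have := enough S large.
    have := mulr_ge0 e_ge0 (ler0n rat #|S|); lra.
  rewrite ltnNge => /negP small.
  (* Equality in the handshake bound makes [d * #|S|] odd, which excludes [#|S| = d + 1]. *)
  have tE : (#|touching F S| * 2)%N = (d * #|S| + 1)%N.
    by have := twice_touching S; lia.
  have dS : (d + 2 <= #|S|)%N.
    have S_odd : odd #|S|.
      by have := congr1 odd tE; rewrite oddM andbF oddD oddM d_odd addbT => /esym/negbFE.
    rewrite addn2 ltn_neqAle; apply/andP; split.
      by apply: contraTneq S_odd => <-; rewrite /= d_odd.
    rewrite ltnNge; apply/negP => Sd; apply: small.
    exact: touching_small.
  (* By [tE] only 1 / 2 is missing, and [#|S|] >= d + 2 makes the subtracted term supply it. *)
  have : 1 / 2 <= 1 / (2 * (d%:R + 2)) * #|S|%:R :> rat.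
    rewrite mulrAC ler_pdivlMr ?mul1r; last lra.
    by move: dS; rewrite -(ler_nat rat) natrD; lra.
  by move/(congr1 (fun k => k%:R : rat)): tE; rewrite natrD !natrM; lra.
- move=> conn n Vn; apply: wsat_ge => // [|S S0 ST]; first lra.
  apply: enough; case: conn => [[d_even Fconn]|F2].
    have b_gt0 := connected_boundary Fconn S0 ST.
    (* For even d, both 2 t(S) and d [#|S|] are even, so a gap of at least 1 is a gap of at least
       2. *)
    have := twice_touching S; rewrite -[d]even_halfK //; lia.
  apply: leq_trans (twice_touching S); rewrite leq_add2l.
  exact: edge_connected_boundary.
Qed.
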